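(* Let $n\geq 6$ be a natural number, and let $L(m)$ denote the number of lattices with $m$ elements, up to isomorphism. Then there exist at least $L(n-5)$ common meadows with $2n$ elements, up to isomorphism (i.e. at least $L(n-5)$ pairwise non-isomorphic ones).
   Context: A pre-meadow is a structure $(P,+,-,\cdot)$ with two binary operations $+,\cdot$, a unary operation $-$ and constants $0,1$, satisfying for all $x,y,z\in P$: $(x+y)+z=x+(y+z)$; $x+y=y+x$; $x+0=x$; $x+(-x)=0\cdot x$; $(x\cdot y)\cdot z=x\cdot(y\cdot z)$; $x\cdot y=y\cdot x$; $1\cdot x=x$; $x\cdot(y+z)=x\cdot y+x\cdot z$; $-(-x)=x$; $0\cdot(x+y)=0\cdot x+0\cdot y$. For a pre-meadow $P$, let $0\cdot P=\{0\cdot x\mid x\in P\}$ and, for $z\in 0\cdot P$, let $P_z=\{x\in P\mid 0\cdot x=z\}$. $P$ is a pre-meadow with $\mathbf{a}$ if there exists a unique $z\in 0\cdot P$ with $|P_z|=1$, this $z$ being denoted $\mathbf{a}$, and moreover $x+\mathbf{a}=\mathbf{a}$ for all $x\in P$. A common meadow is a pre-meadow with $\mathbf{a}$, $M$, equipped with a (total) inverse function $(\cdot)^{-1}:M\to M$ such that for all $x,y\in M$: $x\cdot x^{-1}=1+0\cdot x^{-1}$; $(x\cdot y)^{-1}=x^{-1}\cdot y^{-1}$; $(1+0\cdot x)^{-1}=1+0\cdot x$; $0^{-1}=\mathbf{a}$. An isomorphism of common meadows is a bijection preserving $0$, $1$, $+$, $\cdot$, $-$ and $(\cdot)^{-1}$.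 *)

(* Defs.v *)
From HB Require Import structures.
From mathcomp Require Import all_boot all_order all_fingroup.
From mathcomp Require Import boolp classical_sets cardinality.

Set Implicit Arguments.
Unset Strict Implicit.
Unset Printing Implicit Defensive.

Declare Scope meadow_scope.
Delimit Scope meadow_scope with meadow.
Local Open Scope meadow_scope.
Local Open Scope classical_set_scope.
Local Open Scope card_scope.

HB.mixin Record isPreMeadow P := {
  mzero : P;
  mone : P;
  madd : P -> P -> P;
  mopp : P -> P;
  mmul : P -> P -> P;
  maddA : forall x y z, madd (madd x y) z = madd x (madd y z);
  maddC : forall x y, madd x y = madd y x;
  maddr0 : forall x, madd x mzero = x;
  maddrN : forall x, madd x (mopp x) = mmul mzero x;
  mmulA : forall x y z, mmul (mmul x y) z = mmul x (mmul y z);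
  mmulC : forall x y, mmul x y = mmul y x;
  mmul1r : forall x, mmul mone x = x;
  mmulDr : forall x y z, mmul x (madd y z) = madd (mmul x y) (mmul x z);
  moppK : forall x, mopp (mopp x) = x;
  mmul0D : forall x y,
    mmul mzero (madd x y) = madd (mmul mzero x) (mmul mzero y)
}.

#[short(type="preMeadowType")]
HB.structure Definition PreMeadow := { P of isPreMeadow P }.

Notation "0" := mzero : meadow_scope.
Notation "1" := mone : meadow_scope.
Notation "x + y" := (madd x y) : meadow_scope.
Notation "- x" := (mopp x) : meadow_scope.
Notation "x * y" := (mmul x y) : meadow_scope.

Definition zero_multiples (P : preMeadowType) : set P :=
  [set 0 * x | x in [set: P]].

Definition zero_fiber (P : preMeadowType) (z : P) : set P :=
  [set x | 0 * x = z].

Definition singleton_fiber (P : preMeadowType) (z : P) : Prop :=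
  zero_multiples z /\ zero_fiber z #= `I_1.

(* The element [ma] is a field rather than an existential, but it carries no
   extra data: [ma_unique] determines it. *)
HB.mixin Record PreMeadow_hasA P of PreMeadow P := {
  ma : P;
  ma_unique : unique (@singleton_fiber P) ma;
  maddra : forall x : P, x + ma = ma
}.

#[short(type="preMeadowWithAType")]
HB.structure Definition PreMeadowWithA :=
  { P of PreMeadow P & PreMeadow_hasA P }.

HB.mixin Record PreMeadowWithA_hasInv M of PreMeadowWithA M := {
  minv : M -> M;
  mmulrV : forall x : M, x * minv x = 1 + 0 * minv x;
  minvM : forall x y : M, minv (x * y) = minv x * minv y;
  minv1D0 : forall x : M, minv (1 + 0 * x) = 1 + 0 * x;
  minv0 : minv 0 = ma
}.

#[short(type="commonMeadowType")]
HB.structure Definition CommonMeadow :=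
  { M of PreMeadowWithA M & PreMeadowWithA_hasInv M }.

Record is_meadow_iso (M N : commonMeadowType) (f : M -> N) : Prop := {
  meadow_iso_bij : bijective f;
  meadow_iso0 : f 0 = 0;
  meadow_iso1 : f 1 = 1;
  meadow_isoD : forall x y, f (x + y) = f x + f y;
  meadow_isoM : forall x y, f (x * y) = f x * f y;
  meadow_isoN : forall x, f (- x) = - f x;
  meadow_isoV : forall x, f (minv x) = minv (f x)
}.

Definition meadow_isomorphic (M N : commonMeadowType) : Prop :=
  exists f : M -> N, is_meadow_iso f.

(* The lattices with m elements are counted through their copies on 'I_m: the
   relations on 'I_m that are the order of a lattice, up to relabelling. *)
Definition lattice_order (m : nat) (r : {ffun 'I_m * 'I_m -> bool}) : Prop :=
  exists (d : Order.disp_t) (T : latticeType d) (f : 'I_m -> T),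
    bijective f /\ forall i j, r (i, j) = (f i <= f j)%O.

Definition order_isomorphic (m : nat) :
    rel {ffun 'I_m * 'I_m -> bool} :=
  fun r r' => [exists s : {perm 'I_m},
    [forall i, forall j, r (i, j) == r' (s i, s j)]].

Lemma order_isomorphic_equiv (m : nat) :
  equivalence_rel (@order_isomorphic m).
Proof.
have sym (r r' : {ffun 'I_m * 'I_m -> bool}) :
    order_isomorphic r r' -> order_isomorphic r' r.
  case/existsP=> s /'forall_'forall_eqP rr'; apply/existsP; exists s^-1%g.
  by apply/'forall_'forall_eqP=> i j; rewrite rr' !permKV.
have trans (r1 r2 r3 : {ffun 'I_m * 'I_m -> bool}) :
    order_isomorphic r1 r2 -> order_isomorphic r2 r3 -> order_isomorphic r1 r3.
  case/existsP=> s /'forall_'forall_eqP r12.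
  case/existsP=> t /'forall_'forall_eqP r23; apply/existsP; exists (s * t)%g.
  by apply/'forall_'forall_eqP=> i j; rewrite r12 r23 !permM.
move=> r1 r2 r3; split.
  by apply/existsP; exists 1%g; apply/'forall_'forall_eqP=> i j; rewrite !perm1.
move=> r12; apply/idP/idP; first exact/trans/sym.
exact: trans.
Qed.

Definition num_lattices (m : nat) : nat :=
  #|equivalence_partition (@order_isomorphic m)
      [set r : {ffun 'I_m * 'I_m -> bool} | `[< lattice_order r >]]%SET|.

(* Main.v *)
Require Import Defs.
From HB Require Import structures.
From mathcomp Require Import all_boot all_order all_algebra all_fingroup.
From mathcomp Require Import boolp classical_sets cardinality.
From mathcomp Require Import zify.
Local Open Scope classical_set_scope.
Local Open Scope card_scope.

(**
A common meadow is a family of commutative rings P_z indexed by the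
semilattice of its zeros z, with transition maps x |-> x + z, such that for
each x there is a largest index, at or below that of x, at which the image of
x is invertible; the inverse of x is computed in that ring.  A lattice can
therefore be encoded in the semilattice of zeros, provided that the rings make
inverses exist and the encoded part can be told apart from the rest.

Given a lattice L with m >= 1 elements, hence with a largest element, take the
diagram of rings
<<
                 F x K
                /     \
    F, one copy        K
   for each l in L    /
                \    /
               absorbing
>>
where F and K are fields and the maps are the two projections, identities
between the copies of F, and the maps to the zero ring at the bottom.  This is
a common meadow for all fields F and K: (x, y) is inverted in F x K if x and y
are nonzero, in the copy of F at the top of L if only x is nonzero, in K if
only y is nonzero, and is sent to the absorbing element if both vanish.

With F = F_2 and K = F_3 it has 6 + 2m + 3 + 1 = 2m + 10 elements, which is 2n
for m = n - 5.  The odd field K serves to make the number of elements even,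
and it also makes L recoverable: the zeros of the copies of F are exactly the
zeros z other than the absorbing element with z + (1 + 1) = z
([glue_char2_zero]), and their products are the meets in L ([glue_le_mul]).
This description is preserved by isomorphisms, so isomorphic meadows come from
isomorphic lattices ([meadow_iso_order_iso]).
*)

Set Implicit Arguments.
Unset Strict Implicit.
Unset Printing Implicit Defensive.

(** * Recovering a lattice from a common meadow *)

(** The zeros of the nonzero component rings of characteristic 2: the unit of
the component with zero z is 1 + z, and (1 + z) + (1 + z) = z + (1 + 1). *)
Definition char2_zero (M : commonMeadowType) (z : M) : Prop :=
  [/\ (0 * z = z)%meadow, (z + (1 + 1) = z)%meadow & z <> ma].

(** The product of two zeros is the meet of their components, so that
[e i * e j = e i] says that [e i] lies below [e j]. *)
Definition orders_char2_zeros (M : commonMeadowType) (m : nat)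
    (r : {ffun 'I_m * 'I_m -> bool}) : Prop :=
  exists e : 'I_m -> M,
    [/\ injective e, forall z, char2_zero z <-> exists i, z = e i
      & forall i j, r (i, j) <-> (e i * e j = e i)%meadow].

Lemma char2_zero_iso (M N : commonMeadowType) (f : M -> N) (z : M) :
  is_meadow_iso f -> char2_zero z -> char2_zero (f z).
Proof.
move=> [/bij_inj f_inj f0 f1 fD fM fN fV] [z0 z2 za].
have fa : f ma = ma by rewrite -!minv0 fV f0.
split; first by rewrite -f0 -fM z0.
  by rewrite -f1 -!fD z2.
by rewrite -fa => /f_inj.
Qed.

(** An isomorphism matches the zeros of characteristic 2 and preserves their
products, so the labelled orders that they carry differ by a relabelling. *)
Lemma meadow_iso_order_iso (M N : commonMeadowType) (m : nat)
    (r r' : {ffun 'I_m * 'I_m -> bool}) :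
  orders_char2_zeros M r -> orders_char2_zeros N r' ->
  meadow_isomorphic M N -> order_isomorphic r r'.
Proof.
move=> [e [e_inj eP er]] [e' [e'_inj e'P e'r]] [f isof].
have /choice[s sE] i : exists j, f (e i) = e' j.
  by apply/e'P/char2_zero_iso/eP => //; exists i.
have f_inj := bij_inj (meadow_iso_bij isof).
have s_inj : injective s.
  by move=> i j sij; apply/e_inj/f_inj; rewrite !sE sij.
apply/existsP; exists (perm s_inj); apply/'forall_'forall_eqP => i j.
rewrite !permE; apply/idP/idP => [/er eij|/e'r]; last first.
  by rewrite -!sE -(meadow_isoM isof) => /f_inj/er.
by apply/e'r; rewrite -!sE -(meadow_isoM isof) eij.
Qed.

(** * The common meadow of a semilattice with top and two fields *)

(** The disjoint union of the component rings: F x K, the copies of F indexed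
by L, K, and the zero ring. *)
Inductive glued (L : Type) (F K : Type) : Type :=
  | Both of F & K
  | Left of L & F
  | Right of K
  | Absorbing.

Arguments Both {L F K}.
Arguments Left {L F K}.
Arguments Right {L F K}.
Arguments Absorbing {L F K}.

Section Gluing.
Local Open Scope ring_scope.
Import Order.TTheory GRing.Theory.
Variables (d : Order.disp_t) (L : tMeetSemilatticeType d) (F K : fieldType).
Local Notation G := (glued L F K).

(** An operation of the component rings acts on two elements after both are
sent to the component at the meet of their indices.  Addition and
multiplication are both of this form. *)
Definition glue2 (f : F -> F -> F) (g : K -> K -> K) (u v : G) : G :=
  match u, v with
  | Both x y, Both x' y' => Both (f x x') (g y y')
  | Both x _, Left l x' | Left l x, Both x' _ => Left l (f x x')
  | Left l x, Left l' x' => Left (Order.meet l l') (f x x')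
  | Both _ y, Right y' | Right y, Both _ y' | Right y, Right y' =>
      Right (g y y')
  | _, _ => Absorbing
  end.

Definition glue_opp (u : G) : G :=
  match u with
  | Both x y => Both (- x) (- y)
  | Left l x => Left l (- x)
  | Right y => Right (- y)
  | Absorbing => Absorbing
  end.

Definition left_inv (l : L) (x : F) : G :=
  if x == 0 then Absorbing else Left l x^-1.

Definition right_inv (y : K) : G :=
  if y == 0 then Absorbing else Right y^-1.

(** [Both x 0] becomes invertible in every copy of F, and the inverse lies in
the largest of them: this is where L must have a top. *)
Definition glue_inv (u : G) : G :=
  match u with
  | Both x y =>
      if y == 0 then left_inv \top%O x
      else if x == 0 then right_inv y else Both x^-1 y^-1
  | Left l x => left_inv l x
  | Right y => right_inv y
  | Absorbing => Absorbing
  end.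

Let add := glue2 +%R +%R.
Let mul := glue2 *%R *%R.

Lemma glue2C f g : commutative f -> commutative g -> commutative (glue2 f g).
Proof.
move=> fC gC [x y|l x|y|] [x' y'|l' x'|y'|] //=; rewrite 1?fC 1?gC //.
by rewrite meetC.
Qed.

Lemma glue2A f g : associative f -> associative g ->
  forall u v w, glue2 f g (glue2 f g u v) w = glue2 f g u (glue2 f g v w).
Proof.
move=> fA gA [x y|l x|y|] [x' y'|l' x'|y'|] [x'' y''|l'' x''|y''|] //=;
  by rewrite ?fA ?gA ?meetA.
Qed.

Lemma glue_addr0 u : add u (Both 0 0) = u.
Proof. by case: u => [x y|l x|y|] //=; rewrite !addr0. Qed.

Lemma glue_addrN u : add u (glue_opp u) = mul (Both 0 0) u.
Proof. by case: u => [x y|l x|y|] //=; rewrite ?meetxx !subrr !mul0r. Qed.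

Lemma glue_mul1r u : mul (Both 1 1) u = u.
Proof. by case: u => [x y|l x|y|] //=; rewrite !mul1r. Qed.

Lemma glue_mulDr u v w : mul u (add v w) = add (mul u v) (mul u w).
Proof.
case: u v w => [x y|l x|y|] [x' y'|l' x'|y'|] [x'' y''|l'' x''|y''|] //=;
  rewrite ?mulrDr ?meetxx //.
- by rewrite meetA meetxx.
- by rewrite meetAC meetxx.
by rewrite meetACA meetxx.
Qed.

Lemma glue_oppK : involutive glue_opp.
Proof. by case=> [x y|l x|y|] //=; rewrite !opprK. Qed.

Lemma glue_mul0D u v :
  mul (Both 0 0) (add u v) = add (mul (Both 0 0) u) (mul (Both 0 0) v).
Proof. exact: glue_mulDr. Qed.

HB.instance Definition _ := isPreMeadow.Build G
  (glue2A (@addrA F) (@addrA K)) (glue2C (@addrC F) (@addrC K))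
  glue_addr0 glue_addrN
  (glue2A (@mulrA F) (@mulrA K)) (glue2C (@mulrC F) (@mulrC K))
  glue_mul1r glue_mulDr glue_oppK glue_mul0D.

(* The instance hides the operations from simplification; these equations
   expose them. *)
Let zeroE : 0%meadow = Both 0 0 :> G. Proof. by []. Qed.
Let oneE : 1%meadow = Both 1 1 :> G. Proof. by []. Qed.
Let addE (u v : G) : (u + v)%meadow = add u v. Proof. by []. Qed.
Let mulE (u v : G) : (u * v)%meadow = mul u v. Proof. by []. Qed.
Let glueE := (zeroE, oneE, addE, mulE).

(** A component with at most one element satisfies 0 = 1 there, which fails in
the fields F and K and in their product. *)
Lemma glue_absorbing_unique : unique (@singleton_fiber G) Absorbing.
Proof.
split.
  split; first by exists Absorbing.
  suff -> : zero_fiber (Absorbing : G) = [set Absorbing] by exact: card_set1.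
  by apply/seteqP; split=> [[]|_ ->].
move=> _ [[w _ <-] /eq_cardSP[t _]]; rewrite II0 card_eq0 => /eqP fiber_t.
have eq_t (u : G) : (0 * u = 0 * w)%meadow -> u = t.
  by move=> wu; apply: contrapT => neq_ut;
    have: (zero_fiber (0 * w)%meadow `\ t) u by []; rewrite fiber_t.
have: (0 * w = 1 + 0 * w)%meadow.
  transitivity t; [|symmetry]; apply: eq_t;
    by rewrite !glueE; case: (w) => [x y|l x|y|] //=;
    rewrite ?mul0r ?addr0 ?mulr0.
by rewrite !glueE; case: (w) => [x y|l x|y|] //= [] // /eqP;
  rewrite !mul0r addr0 eq_sym oner_eq0.
Qed.

Lemma glue_addra (u : G) : (u + Absorbing)%meadow = Absorbing.
Proof. by case: u. Qed.

HB.instance Definition _ :=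
  PreMeadow_hasA.Build G glue_absorbing_unique glue_addra.

Lemma glue_mulrV (u : G) :
  (u * glue_inv u)%meadow = (1 + 0 * glue_inv u)%meadow.
Proof.
rewrite !glueE; case: u => [x y|l x|y|] //=; rewrite /left_inv /right_inv.
- by case: (eqVneq y 0) => [_|y0]; case: (eqVneq x 0) => [_|x0] //=;
    rewrite ?mulfV // !mul0r !addr0.
- by case: (eqVneq x 0) => [_|x0] //=; rewrite meetxx mulfV // mul0r addr0.
by case: (eqVneq y 0) => [_|y0] //=; rewrite mulfV // mul0r addr0.
Qed.

Lemma glue_invM (u v : G) :
  glue_inv (u * v)%meadow = (glue_inv u * glue_inv v)%meadow.
Proof.
rewrite !glueE; case: u v => [x y|l x|y|] [x' y'|l' x'|y'|] //=;
  rewrite /left_inv /right_inv ?mulf_eq0; do ?[case: (eqVneq _ 0) => [_|_] //=];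
  by rewrite ?invfM ?meetxx ?meet1x ?meetx1.
Qed.

Lemma glue_inv1D0 (u : G) :
  glue_inv (1 + 0 * u)%meadow = (1 + 0 * u)%meadow.
Proof.
by rewrite !glueE; case: u => [x y|l x|y|] //=;
  rewrite /left_inv /right_inv !mul0r !addr0 !oner_eq0 !invr1.
Qed.

Lemma glue_inv0 : glue_inv 0%meadow = ma.
Proof. by rewrite /= /left_inv !eqxx. Qed.

HB.instance Definition _ := PreMeadowWithA_hasInv.Build G
  glue_mulrV glue_invM glue_inv1D0 glue_inv0.

(** K having characteristic other than 2 excludes the components F x K and K,
and the absorbing element is excluded by definition. *)
Lemma glue_char2_zero (u : G) :
    1 + 1 = 0 :> F -> 1 + 1 != 0 :> K ->
  char2_zero u <-> exists l, u = Left l 0.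
Proof.
move=> F2 K2; split=> [[]|[l ->]]; last first.
  by split=> //; rewrite !glueE /= ?mul0r ?F2 ?add0r.
rewrite !glueE; case: u => [x y|l x|y|] //=.
- rewrite mul0r => -[_ <-] [_ /eqP].
  by rewrite mul0r add0r (negPf K2).
- by rewrite mul0r => -[<-] _ _; exists l.
by rewrite mul0r => -[<-] [/eqP]; rewrite add0r (negPf K2).
Qed.

Lemma glue_le_mul (l l' : L) :
  (l <= l')%O <-> (Left l 0%R * Left l' 0%R = Left l 0%R :> G)%meadow.
Proof.
rewrite glueE /= mul0r leEmeet; split=> [/eqP -> //|[->]]; exact: eqxx.
Qed.

End Gluing.

(** * The meadows built from F_2 and F_3 *)

Lemma finite_lattice_top (d : Order.disp_t) (T : latticeType d) (m : nat)
    (f : 'I_m -> T) : (0 < m)%N -> bijective f ->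
  exists t : T, forall x, (x <= t)%O.
Proof.
case: m f => // m f _ [g _ gK].
have ubP (s : seq T) : exists t : T, forall x, x \in s -> (x <= t)%O.
  elim: s => [|y s [t IH]]; first by exists (f ord0).
  exists (Order.join y t) => x; rewrite inE => /predU1P[->|/IH xt].
    exact: Order.JoinTheory.leUl.
  exact/(Order.POrderTheory.le_trans xt)/Order.JoinTheory.leUr.
have [t tP] := ubP (codom f); exists t => x; apply: tP;
  by rewrite -[x]gK codom_f.
Qed.

Lemma card_setT_bij (J : finType) (T : Type) (g : J -> T) :
  bijective g -> [set: T] #= `I_#|J|.
Proof.
have inj_card (A B : Type) (h : A -> B) : bijective h -> [set: B] #= [set: A].
  case=> k hK kK; suff <- : h @` [set: A] = [set: B].
    by apply: inj_card_eq => x y _ _ /(can_inj hK).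
  by apply/seteqP; split=> // y _; exists (k y).
move=> /inj_card TJ; apply: (card_eq_trans TJ); rewrite card_eq_sym.
apply: (card_eq_trans card_II); rewrite card_eq_sym.
exact: inj_card (@enum_val_bij J).
Qed.

Section Gluing_F2_F3.
Local Open Scope ring_scope.
Variables (d : Order.disp_t) (L : tMeetSemilatticeType d).
Variables (m : nat) (f : 'I_m -> L).
Hypothesis f_bij : bijective f.

Lemma card_glue_F2_F3 : [set: glued L 'F_2 'F_3] #= `I_(2 * m + 10).
Proof.
have [g fK gK] := f_bij.
pose J : finType := ('F_2 * 'F_3 + 'I_m * 'F_2 + 'F_3 + unit)%type.
have -> : (2 * m + 10)%N = #|J|.
  by rewrite !card_sum !card_prod !card_Fp // card_ord card_unit; lia.
pose out (u : J) : glued L 'F_2 'F_3 :=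
  match u with
  | inl (inl (inl (x, y))) => Both x y
  | inl (inl (inr (i, x))) => Left (f i) x
  | inl (inr y) => Right y
  | inr tt => Absorbing
  end.
pose back (u : glued L 'F_2 'F_3) : J :=
  match u with
  | Both x y => inl (inl (inl (x, y)))
  | Left l x => inl (inl (inr (g l, x)))
  | Right y => inl (inr y)
  | Absorbing => inr tt
  end.
apply: (@card_setT_bij J _ out); exists back.
  by case=> [[[[x y]|[i x]]|y]|[]] //=; rewrite fK.
by case=> [x y|l x|y|] //=; rewrite gK.
Qed.

Lemma glue_orders_char2_zeros (r : {ffun 'I_m * 'I_m -> bool}) :
    (forall i j, r (i, j) = (f i <= f j)%O) ->
  orders_char2_zeros (glued L 'F_2 'F_3) r.
Proof.
have [g fK gK] := f_bij; move=> rE.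
exists (fun i => Left (f i) 0); split.
- by move=> i j [/(can_inj fK)].
- move=> z; rewrite glue_char2_zero //; last exact: val_inj.
  by split=> [[l ->]|[i ->]]; [exists (g l); rewrite gK | exists (f i)].
by move=> i j; rewrite rE; apply: glue_le_mul.
Qed.

End Gluing_F2_F3.

(** A lattice order on ['I_m] comes from a lattice T that need not be declared
with a top; finiteness provides one, and T is glued with that top. *)
Lemma lattice_meadow (m : nat) (r : {ffun 'I_m * 'I_m -> bool}) :
  (0 < m)%N -> lattice_order r ->
  exists M : commonMeadowType,
    [set: M] #= `I_(2 * m + 10) /\ orders_char2_zeros M r.
Proof.
move=> m_gt0 [d [T [f [f_bij rE]]]].
have [t tP] := finite_lattice_top m_gt0 f_bij.
pose L : tMeetSemilatticeType d :=
  HB.pack (Order.Lattice.sort T) (Order.hasTop.Build d T tP).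
exists (glued L 'F_2 'F_3 : commonMeadowType); split.
  exact: (@card_glue_F2_F3 d L m f f_bij).
exact: (@glue_orders_char2_zeros d L m f f_bij).
Qed.

Theorem proposition3p5 (n : nat) (hn : (6 <= n)%N) :
  exists F : 'I_(num_lattices (n - 5)) -> commonMeadowType,
    (forall i, [set: F i] #= `I_(2 * n)) /\
    (forall i j, i <> j -> ~ meadow_isomorphic (F i) (F j)).
Proof.
have m_gt0 : (0 < n - 5)%N by rewrite subn_gt0.
set D := [set r : {ffun 'I_(n - 5) * 'I_(n - 5) -> bool} |
           `[< lattice_order r >]]%SET.
have /choice[F FP] (i : 'I_(num_lattices (n - 5))) :
    (* one meadow for a representative r of each isomorphism class *)
    exists M : commonMeadowType, [set: M] #= `I_(2 * n) /\
      exists r, orders_char2_zeros M r /\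
        enum_val i = [set r' in D | order_isomorphic r r']%SET.
  have /imsetP[r + r_class] := enum_valP i.
  rewrite inE => /asboolP/(lattice_meadow m_gt0)[M [cardM rM]].
  exists M; split; last by exists r.
  by rewrite (_ : 2 * n = 2 * (n - 5) + 10)%N //; lia.
exists F; split=> [i|i j neq_ij isoF]; first by case: (FP i).
have [_ [r [rF ri]]] := FP i; have [_ [r' [r'F rj]]] := FP j.
apply/neq_ij/enum_val_inj; rewrite ri rj; apply/setP => r1; rewrite !inE.
have [_ ->//] := order_isomorphic_equiv r r' r1.
exact: meadow_iso_order_iso rF r'F isoF.
Qed.
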